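(* Let $\gamma\in\mathbb N$, $\gamma\ge 1$, let $\beta\in\overline{\mathbb D}$ and let $\varphi(w)=\beta w$ for $w\in\mathbb D$. Then the Berezin range of the composition operator $C_\varphi$ acting on $\mathcal H_\gamma(\mathbb D)$ is convex if and only if $\beta$ is real with $-1\le\beta\le1$.
   Context: $\mathbb D$ is the open unit disk in $\mathbb C$ and $\overline{\mathbb D}$ its closure. For a positive integer $\gamma$, $\mathcal H_\gamma(\mathbb D)$ is the reproducing kernel Hilbert space of holomorphic functions on $\mathbb D$ with kernel $K_w(z)=(1-\overline wz)^{-\gamma}$, and $\widehat k_w=K_w/\|K_w\|$. $C_\varphi f=f\circ\varphi$. For a bounded operator $A$ on $\mathcal H_\gamma(\mathbb D)$, the Berezin symbol is $\widetilde A(w)=\langle A\widehat k_w,\widehat k_w\rangle$, $w\in\mathbb D$, and the Berezin range is $\mathrm{Ber}(A)=\{\widetilde A(w): w\in\mathbb D\}$. *)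

(* Defs.v *)
From HB Require Import structures.
From mathcomp Require Import all_boot all_order all_algebra complex.
From mathcomp Require Import boolp classical_sets functions reals.
From mathcomp Require Import topology normedtype derive convex.

Set Implicit Arguments.
Unset Strict Implicit.
Unset Printing Implicit Defensive.

Import Order.TTheory GRing.Theory Num.Theory.
Import numFieldNormedType.Exports.
Local Open Scope classical_set_scope.
Local Open Scope ring_scope.

(* A complex reproducing kernel Hilbert space over a set X: a linear space
   [rkhs_space] of functions on X, complete for its inner product, with
   [K w] the reproducing kernel at w.  The inner product is linear in its first
   argument.  As a Rocq function [rkhs_dot] is total, but it is constrained
   (and meaningful) only on [rkhs_space]. *)
Record rkhs (R : realType) (X : Type) (K : X -> X -> R[i]^o) : Type := Rkhs {
  rkhs_space :> set (X -> R[i]^o) ;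
  rkhs_dot : (X -> R[i]^o) -> (X -> R[i]^o) -> R[i] ;
  rkhs0 : rkhs_space 0 ;
  rkhs_linear : forall (a : R[i]) f g,
    rkhs_space f -> rkhs_space g -> rkhs_space (a *: f + g) ;
  rkhs_dot_linear : forall (a : R[i]) f g h,
    rkhs_space f -> rkhs_space g -> rkhs_space h ->
    rkhs_dot (a *: f + g) h = a * rkhs_dot f h + rkhs_dot g h ;
  rkhs_dot_conj : forall f g,
    rkhs_space f -> rkhs_space g -> rkhs_dot g f = (rkhs_dot f g)^* ;
  rkhs_dot_gt0 : forall f, rkhs_space f -> f <> 0 -> 0 < rkhs_dot f f ;
  rkhs_complete : forall u : nat -> X -> R[i]^o,
    (forall n, rkhs_space (u n)) ->
    (forall e : R[i], 0 < e -> exists N : nat, forall m n : nat,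
       (N <= m)%N -> (N <= n)%N ->
       sqrtC (rkhs_dot (u m - u n) (u m - u n)) < e) ->
    exists2 f, rkhs_space f &
      forall e : R[i], 0 < e -> exists N : nat, forall n : nat,
        (N <= n)%N -> sqrtC (rkhs_dot (u n - f) (u n - f)) < e ;
  rkhs_kernel : forall w, rkhs_space (K w) ;
  rkhs_reproducing : forall f w, rkhs_space f -> rkhs_dot f (K w) = f w
}.

Definition rkhs_norm (R : realType) (X : Type) (K : X -> X -> R[i]^o)
    (H : rkhs K) (f : X -> R[i]^o) : R[i] :=
  sqrtC (rkhs_dot H f f).

Definition normalized_kernel (R : realType) (X : Type) (K : X -> X -> R[i]^o)
    (H : rkhs K) (w : X) : X -> R[i]^o :=
  (rkhs_norm H (K w))^-1 *: K w.

Definition berezin_symbol (R : realType) (X : Type) (K : X -> X -> R[i]^o)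
    (H : rkhs K) (A : (X -> R[i]^o) -> (X -> R[i]^o)) (w : X) : R[i]^o :=
  rkhs_dot H (A (normalized_kernel H w)) (normalized_kernel H w).

Definition berezin_range (R : realType) (X : Type) (K : X -> X -> R[i]^o)
    (H : rkhs K) (A : (X -> R[i]^o) -> (X -> R[i]^o)) : set R[i]^o :=
  range (berezin_symbol H A).

Definition composition_operator (R : realType) (X : Type) (phi : X -> X)
    (f : X -> R[i]^o) : X -> R[i]^o := f \o phi.

Definition disk (R : realType) : Type := {z : R[i] | `|z| < 1}.

(* Since the disk is open, complex differentiability at its points does not
   depend on the extension F of f. *)
Definition holomorphic_on_disk (R : realType) (f : disk R -> R[i]^o) : Prop :=
  exists F : R[i]^o -> R[i]^o, forall z : disk R,
    F (val z) = f z /\ derivable F (val z) 1.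

Definition disk_kernel (R : realType) (gamma : nat) (w z : disk R) : R[i]^o :=
  ((1 - (val w)^* * val z) ^+ gamma)^-1.

(* The space H_gamma of the disk; as a set of functions with an inner product
   on it, it is determined by its kernel. *)
Record weighted_hardy (R : realType) (gamma : nat) : Type := WeightedHardy {
  weighted_hardy_rkhs :> rkhs (@disk_kernel R gamma) ;
  weighted_hardy_holomorphic : forall f,
    rkhs_space weighted_hardy_rkhs f -> holomorphic_on_disk f
}.

Lemma disk_scale_subproof (R : realType) (beta : R[i]) (hbeta : `|beta| <= 1)
  (w : disk R) : `|beta * val w| < 1.
Proof.
by rewrite normrM (le_lt_trans _ (valP w))// ler_piMl.
Qed.

Definition disk_scale (R : realType) (beta : R[i]) (hbeta : `|beta| <= 1)
    (w : disk R) : disk R :=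
  exist _ (beta * val w) (disk_scale_subproof hbeta w).

(* w |-> beta w acts on normalized kernels inside the space, so in its Berezin
   symbol the inner product is evaluated at elements of the space only. *)
Lemma composition_disk_scale_mem (R : realType) (gamma : nat) (beta : R[i])
    (hbeta : `|beta| <= 1) (H : weighted_hardy R gamma) (w : disk R) :
  rkhs_space H
    (composition_operator (disk_scale hbeta) (normalized_kernel H w)).
Proof.
have hbetac : `|beta^*| <= 1 by rewrite norm_conjC.
have -> : composition_operator (disk_scale hbeta) (normalized_kernel H w) =
    (rkhs_norm H (disk_kernel gamma w))^-1 *:
      disk_kernel gamma (disk_scale hbetac w) + 0.
  apply/funext => z.
  rewrite addr0 /composition_operator /normalized_kernel /=.
  congr (_ *: _); rewrite /disk_kernel /=.
  by rewrite rmorphM /= conjCK mulrCA mulrA.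
by apply: rkhs_linear; [exact: rkhs_kernel | exact: rkhs0].
Qed.

(* Main.v *)
(** Since [|k_w|^2] is the value of the kernel on the diagonal, the Berezin
    symbol at [w] is [g(t) = ((1 - t) / (1 - beta t))^gamma] with [t = |w|^2], so
    the Berezin range is the curve [g([0, 1[)].  If [beta = 1] it is the point
    [1], and if [-1 <= beta < 1] it is the interval [(0, 1]].

    Conversely, if the curve is convex, it contains the segment from [g(0) = 1]
    to any [g(t)].  Lying on a line is a polynomial condition on the parameter;
    having infinitely many solutions, it holds identically, and evaluating it
    at the parameter 1, where the curve tends to 0, shows that the line is the
    real axis.  So [g] is real, which means that the polynomials
    [(1 - beta X)^gamma] and [(1 - beta^* X)^gamma] agree; their linear
    coefficients give [beta = beta^*]. *)
Require Import Defs.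
From HB Require Import structures.
From mathcomp Require Import all_boot all_order all_algebra complex.
From mathcomp Require Import boolp classical_sets functions reals.
From mathcomp Require Import topology normedtype derive convex.
From mathcomp Require Import interval_inference ring.
Import Order.TTheory GRing.Theory Num.Theory.
Import numFieldNormedType.Exports.
Local Open Scope classical_set_scope.
Local Open Scope ring_scope.

Lemma poly_eq0_of_injective_roots (F : idomainType) (p : {poly F})
    (x : nat -> F) : injective x -> (forall n, root p (x n)) -> p = 0.
Proof.
move=> xI px; apply/eqP; apply/negPn/negP => p0.
(* A nonzero [p] has fewer than [size p] distinct roots, while the first [size p] values of [x]
   would be that many. *)
have /= := @max_poly_roots _ p (map x (iota 0 (size p))) p0.
rewrite size_map size_iota ltnn map_inj_uniq ?iota_uniq // => lt_roots.
suff: false by []; apply: lt_roots => //.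
by apply/allP => _ /mapP[n _ ->].
Qed.

Section BerezinCurve.
Variables (C : numClosedFieldType) (gamma : nat) (beta : C).
Hypotheses (gamma_gt0 : (0 < gamma)%N) (beta_le1 : `|beta| <= 1).

(** The parameter lives in [C] itself, where [0 <= t < 1] already forces [t] to be real. *)
Definition berezin_curve (t : C) : C := ((1 - t) / (1 - beta * t)) ^+ gamma.

Lemma one_sub_scale_neq0 (b t : C) :
  `|b| <= 1 -> 0 <= t < 1 -> 1 - b * t != 0.
Proof.
move=> b1 /andP[t0 t1]; rewrite subr_eq0.
apply: contraTneq isT => /(congr1 Num.norm); rewrite normr1 normrM (ger0_norm t0) => E.
have : `|b| * t < 1 by apply: le_lt_trans t1; rewrite ler_piMl.
by rewrite -E ltxx.
Qed.

Lemma real_of_berezin_curve_real :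
  (forall t, 0 <= t < 1 -> berezin_curve t \is Num.real) -> beta \is Num.real.
Proof.
move=> gR.
pose P : {poly C} := (1 - beta^* *: 'X) ^+ gamma - (1 - beta *: 'X) ^+ gamma.
have P0 : P = 0.
  (* Starting at 1/2 keeps every sample point strictly below 1, so that the factor
     [(1 - x n) ^+ gamma] can be cancelled. *)
  pose x n : C := n.+2%:R^-1.
  apply: (@poly_eq0_of_injective_roots _ _ x).
    by move=> m n /invr_inj /eqP; rewrite eqr_nat => /eqP [].
  move=> n.
  have x0 : 0 <= x n by rewrite invr_ge0.
  have x1 : x n < 1 by rewrite invf_lt1 // ltr1n.
  have x01 : 0 <= x n < 1 by rewrite x0.
  have := gR _ x01; rewrite CrealE /berezin_curve.
  rewrite rmorphXn /= !rmorphM /= fmorphV !rmorphB /= !rmorphM /= rmorph1.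
  rewrite (conj_Creal (ger0_real x0)) !expr_div_n eq_sym.
  have nz : (1 - x n) ^+ gamma != 0 by rewrite expf_neq0 // subr_eq0 gt_eqF.
  rewrite (inj_eq (mulfI nz)) (inj_eq invr_inj) => /eqP E.
  by rewrite /root !hornerE E subrr.
(* The derivative at 0 extracts the linear coefficient, [gamma] times the difference of [beta] and
   its conjugate. *)
have := congr1 (fun q : {poly C} => q^`().[0]) P0.
rewrite /P linearB /= !deriv_exp !linearB /= -!polyC1 !derivC !linearZ /= !derivX.
rewrite !(hornerMn, hornerM, hornerZ, horner_exp, hornerD, hornerN).
rewrite !(hornerX, hornerC).
rewrite !(mulr0, oppr0, addr0, expr1n, mulr1, mulrN1).
rewrite !sub0r -mulrnBl opprK addrC.
move/eqP; rewrite mulrn_eq0 eqn0Ngt gamma_gt0 /= subr_eq0 eq_sym.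
by rewrite CrealE.
Qed.

Hypothesis curve_convex : forall s t k : C, 0 <= s < 1 -> 0 <= t < 1 ->
  0 <= k <= 1 -> exists2 r, 0 <= r < 1 &
    berezin_curve r = k * berezin_curve s + (1 - k) * berezin_curve t.

Lemma berezin_curve_real_of_convex (t : C) :
  beta != 1 -> 0 <= t < 1 -> berezin_curve t \is Num.real.
Proof.
move=> b1 t01; set c := (berezin_curve t - 1)^*.
have g0 : berezin_curve 0 = 1.
  by rewrite /berezin_curve mulr0 subr0 divr1 expr1n.
suff cR : c \is Num.real.
  by rewrite -(subrK 1 (berezin_curve t)) rpredD ?rpred1 // -CrealJ.
have [c0|c0] := eqVneq c 0; first by rewrite c0 rpred0.
pose A : {poly C} := (1 - 'X) ^+ gamma.
pose B (b : C) : {poly C} := (1 - b *: 'X) ^+ gamma.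
(* For real [r], a root of [P] is a point where [c] times [berezin_curve r - 1] equals its own
   conjugate, with the denominators cleared: the curve then meets the line through 1 and
   [berezin_curve t]. *)
pose P := c *: ((A - B beta) * B beta^*) - c^* *: ((A - B beta^*) * B beta).
have P0 : P = 0.
  pose k n : C := n.+2%:R^-1.
  have k01 n : 0 <= k n <= 1 by rewrite invr_ge0 ler0n invf_le1 // ler1n.
  have ex n : exists r, 0 <= r < 1 /\ berezin_curve r = 1 + k n * c^*.
    have [|r r01 rE] := @curve_convex t 0 (k n) t01 _ (k01 n).
      by rewrite lexx ltr01.
    by exists r; split=> //; rewrite rE g0 conjCK; ring.
  have [x xE] := choice ex.
  apply: (@poly_eq0_of_injective_roots _ _ x).
    (* As [c] is nonzero, distinct weights [k n] give distinct points of the segment, hence distinct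
       parameters. *)
    move=> m n E; have := (xE m).2; rewrite E (xE n).2 => /addrI /mulIf.
    rewrite conjC_eq0 => /(_ c0) /invr_inj /eqP.
    by rewrite eqr_nat => /eqP [].
  move=> n; have [x01 ] := xE n; have /andP[x0 x1] := x01.
  have xC := conj_Creal (ger0_real x0).
  have kC : (k n)^* = k n by rewrite conj_Creal // ger0_real // invr_ge0.
  have nz : (1 - beta * x n) ^+ gamma != 0.
    by rewrite expf_neq0 // one_sub_scale_neq0.
  rewrite /berezin_curve expr_div_n => /(canRL (divfK nz)) E.
  have := congr1 Num.conj E.
  rewrite rmorphM rmorphD rmorph1 /= rmorphM /= !rmorphXn /= !rmorphB rmorph1 /=.
  rewrite rmorphM /= xC kC conjCK => E'.
  rewrite /root /P /A /B.
  rewrite !(hornerM, hornerZ, horner_exp, hornerD, hornerN, hornerX, hornerC).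
  rewrite {1}E E'; apply/eqP.
  by ring.
(* At 1 the term [A] vanishes, leaving the conjugate of [c] minus [c], times a power of the squared
   modulus of [1 - beta]. *)
have := congr1 (fun q : {poly C} => q.[1]) P0.
rewrite /P /A /B.
rewrite !(hornerM, hornerZ, horner_exp, hornerD, hornerN, hornerX, hornerC).
rewrite subrr expr0n eqn0Ngt gamma_gt0 /= !sub0r !mulr1 !mulNr !mulrN opprK.
rewrite addrC (mulrC (_ ^+ _)) -mulrBl => /eqP; rewrite mulf_eq0 subr_eq0 CrealE.
move=> /orP[//|]; rewrite -exprMn expf_eq0 gamma_gt0 /= mulf_eq0.
by rewrite !subr_eq0 !(eq_sym 1) (negPf b1) /= fmorph_eq1 (negPf b1).
Qed.

End BerezinCurve.

Arguments berezin_curve {C}.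

Section RealParameter.
Variables (C : numClosedFieldType) (gamma : nat) (beta : C).
Hypotheses (gamma_gt0 : (0 < gamma)%N) (beta_lt1 : beta < 1).

Lemma berezin_curve_range (y : C) :
  (0 < y <= 1) <-> exists2 t, 0 <= t < 1 & berezin_curve gamma beta t = y.
Proof.
have den_gt0 t : 0 <= t -> t < 1 -> 0 < 1 - beta * t.
  move=> t0 t1; rewrite subr_gt0; apply: le_lt_trans t1.
  by rewrite ler_piMl // ltW.
split=> [/andP[y0 y1]|[t /andP[t0 t1] <-]].
  set s := gamma.-root y.
  have s0 : 0 < s by rewrite rootC_gt0.
  have s1 : s <= 1 by rewrite rootC_le1 // ltW.
  have bs : beta * s < s by rewrite gtr_pMl.
  have d0 : 0 < 1 - beta * s by rewrite subr_gt0 (lt_le_trans bs).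
  (* The map sending [t] to [(1 - t) / (1 - beta * t)] is an involution, so its value at [s] is a
     preimage of [s]. *)
  exists ((1 - s) / (1 - beta * s)).
    apply/andP; split; first by rewrite divr_ge0 ?(ltW d0) // subr_ge0.
    by rewrite ltr_pdivrMr // mul1r ltrD2l ltrN2.
  rewrite /berezin_curve -[RHS](rootCK gamma_gt0 y) -/s; congr (_ ^+ _).
  field; rewrite gt_eqF //=.
  rewrite (_ : 1 - beta * s - _ = 1 - beta); last by ring.
  by rewrite subr_eq0 eq_sym lt_eqF.
have h0 : 0 < (1 - t) / (1 - beta * t) by rewrite divr_gt0 ?den_gt0 // subr_gt0.
rewrite /berezin_curve exprn_gt0 //= exprn_ile1 ?(ltW h0) //.
by rewrite ler_pdivrMr ?den_gt0 // mul1r lerD2l lerN2 ler_piMl // ltW.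
Qed.

End RealParameter.

Lemma rkhs_dot_scaler (R : realType) (X : Type) (K : X -> X -> R[i]^o) (E : rkhs K)
    (a : R[i]) f g : rkhs_space E f -> rkhs_space E g ->
  rkhs_dot E f (a *: g) = a^* * rkhs_dot E f g.
Proof.
move=> Ef Eg; have E0 := rkhs0 E.
have Eag : rkhs_space E (a *: g) by rewrite -[_ *: _]addr0; exact: rkhs_linear.
rewrite (rkhs_dot_conj Eag Ef) (rkhs_dot_conj Eg Ef) -rmorphM; congr (_^* ).
(* Linearity at zero vectors gives d = d + d for d the product of 0 with [f], so d = 0. *)
have := rkhs_dot_linear 1 E0 E0 Ef.
rewrite scaler0 addr0 mul1r => dot0.
have d0 : rkhs_dot E 0 f = 0.
  by apply: (addrI (rkhs_dot E 0 f)); rewrite addr0.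
by rewrite -[a *: g]addr0 rkhs_dot_linear // d0 addr0.
Qed.

Section BerezinSymbol.
Variables (R : realType) (gamma : nat) (beta : R[i]) (hbeta : `|beta| <= 1).
Variable H : weighted_hardy R gamma.

Lemma berezin_symbol_disk_scale (w : disk R) :
  berezin_symbol H (composition_operator (disk_scale hbeta)) w =
  berezin_curve gamma beta (`|val w| ^+ 2).
Proof.
have Hw := @rkhs_kernel _ _ _ H w.
have HC := composition_disk_scale_mem hbeta H w.
have t1 : 0 < 1 - `|val w| ^+ 2 by rewrite subr_gt0 expr_lt1 // (valP w).
have KwE : disk_kernel gamma w w = ((1 - `|val w| ^+ 2) ^+ gamma)^-1.
  by rewrite /disk_kernel mulrC -normCK.
have n0 : 0 <= rkhs_norm H (disk_kernel gamma w).
  rewrite /rkhs_norm rkhs_reproducing // KwE sqrtC_ge0.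
  by rewrite invr_ge0 exprn_ge0 // ltW.
have nK : (rkhs_norm H (disk_kernel gamma w))^-1 ^+ 2 =
    (1 - `|val w| ^+ 2) ^+ gamma.
  by rewrite exprVn /rkhs_norm sqrtCK rkhs_reproducing // KwE invrK.
(* With the normalizing factor moved out of the second argument, the reproducing property evaluates
   the composed kernel at [w]. *)
rewrite /berezin_symbol {2}/normalized_kernel rkhs_dot_scaler //.
rewrite rkhs_reproducing //.
rewrite conj_Creal ?ger0_real ?invr_ge0 //.
rewrite /composition_operator /normalized_kernel /=.
rewrite [X in _ * X = _]/GRing.scale /= mulrA -expr2 nK.
rewrite /disk_kernel /berezin_curve /= mulrCA [_^* * _]mulrC -normCK.
by rewrite expr_div_n.
Qed.

Lemma berezin_range_disk_scale :
  berezin_range H (composition_operator (disk_scale hbeta)) =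
  [set berezin_curve gamma beta t | t in [set t : R[i] | 0 <= t < 1]].
Proof.
apply/seteqP; split=> [_ [w _ <-]|_ [t /= /andP[t0 t1] <-]].
  exists (`|val w| ^+ 2); last by rewrite berezin_symbol_disk_scale.
  by rewrite /= exprn_ge0 // expr_lt1 // (valP w).
have s1 : `|sqrtC t| < 1 by rewrite ger0_norm ?sqrtC_ge0 // rootC_lt1.
exists (exist _ (sqrtC t) s1) => //.
by rewrite berezin_symbol_disk_scale /= ger0_norm ?sqrtC_ge0 // sqrtCK.
Qed.

End BerezinSymbol.

Theorem theorem3p3 (R : realType) (gamma : nat) (hgamma : (1 <= gamma)%N)
    (beta : R[i]) (hbeta : `|beta| <= 1) (H : weighted_hardy R gamma) :
  convex_set (berezin_range H (composition_operator (disk_scale hbeta))) <->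
  (beta \is Num.real /\ -1 <= beta <= 1).
Proof.
rewrite berezin_range_disk_scale; split=> [cvx|[bR /andP[_ b1]]].
  suff bR : beta \is Num.real by split=> //; rewrite -real_ler_norml.
  have [->|b1] := eqVneq beta 1; first exact: rpred1.
  apply: (real_of_berezin_curve_real _ _ _ hgamma) => t t01.
  apply: (berezin_curve_real_of_convex _ _ _ hgamma hbeta _ _ b1) t01.
  move=> s {}t k s01 t01 /andP[k0 k1].
  have := cvx (berezin_curve gamma beta s) (berezin_curve gamma beta t)
    (Itv01 k0 k1).
  rewrite !inE /= => /(_ (ex_intro2 _ _ s s01 erefl))
    /(_ (ex_intro2 _ _ t t01 erefl))[r /= r01 rE].
  by exists r; rewrite // rE.
have [bE|bN1] := eqVneq beta 1.
  have g1 t : 0 <= t < 1 -> berezin_curve gamma beta t = 1.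
    move=> /andP[_ t1]; rewrite /berezin_curve bE mul1r divff ?expr1n //.
    by rewrite subr_eq0 gt_eqF.
  move=> x y k; rewrite !inE => -[s s01 <-] [t t01 <-].
  by exists s; rewrite // !g1 // convmm.
have b_lt1 : beta < 1 by rewrite lt_neqAle bN1.
have rng := berezin_curve_range _ gamma beta hgamma b_lt1.
move=> x y k; rewrite !inE => /rng/andP[x0 x1] /rng/andP[y0 y1]; apply/rng.
apply/andP; split; first exact: convR_gt0.
(* The bound is taken termwise against 1 = k + (1 - k). *)
rewrite [leLHS]/(k%:num * x + (1 - k%:num) * y) -[leRHS](subrKC k%:num).
by rewrite lerD // ler_piMr // subr_ge0.
Qed.
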